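(* Let $d\ge2$, $\mathcal{H}_A=\mathcal{H}_B=\mathbb{C}^d$, $H_A=\sum_{k=0}^{d-1}\omega_k|k\rangle\langle k|$ and $H_B=\sum_{k=0}^{d-1}\omega_k|k\rangle\langle k|$ with all $\omega_k>0$, and $\omega_{max}=\max_k\omega_k$. Let $g>0$, let $S$ be the SWAP operator on $\mathbb{C}^d\otimes\mathbb{C}^d$, and for $t>0$ let $U_{PS}(t)=e^{-igtS}$. For a density matrix $\rho=\sum_{n,m,n',m'}p_{n,m,n',m'}|n,m\rangle\langle n',m'|$ on $\mathcal{H}_A\otimes\mathcal{H}_B$ put $$\langle\mathcal{Q}_A\rangle_t=\mathrm{Tr}\{(H_A\otimes\mathbb{1})(U_{PS}(t)\rho U_{PS}(t)^\dagger-\rho)\}.$$ Consider the noncontextuality inequality $$-4\omega_{max}\sin^2(gt)\le\langle\mathcal{Q}_A\rangle_t\le2\omega_{max}\sin^2(gt),\qquad( * )$$ whose violation at time $t$ implies that there is no noncontextual ontological model of the fragment $\mathcal{F}_t$ defined in the context. (i) The coherences of $\rho$ have an effect on the heat flow, i.e. $\sum_{n,m}\mathrm{Im}(p_{n,m,m,n})\,\omega_n\neq0$, if and only if there is $\tau_c>0$ such that $( * )$ is violated for all $0<t<\tau_c$. (ii) Suppose that the reduced states of $\rho$ are the Gibbs states $\rho_A=e^{-\beta_AH_A}/Z_A$, $\rho_B=e^{-\beta_BH_B}/Z_B$ with $\beta_A,\beta_B>0$, $\beta_A\ne\beta_B$. Then there is $\tau_c>0$ such that for every $t\in(0,\tau_c)$: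 if the heat flow is anomalous at time $t$, i.e. $(\beta_A-\beta_B)\langle\mathcal{Q}_A\rangle_t<0$, then $( * )$ is violated at time $t$.
   Context: $|n,m\rangle=|n\rangle\otimes|m\rangle$, and $S|n,m\rangle=|m,n\rangle$; $Z_A,Z_B$ are normalizing partition functions. Fragment $\mathcal{F}_t$: the preparation $\rho$; the single measurement $\{E_k\}_k$ given by the spectral projections of $H_A\otimes\mathbb{1}$ (with the eigenvalues of $H_A$ as values); and the channels $\mathrm{id}$, $\mathcal{U}(X)=U_{PS}(t)XU_{PS}(t)^\dagger$, $\mathcal{U}^\dagger(X)=U_{PS}(t)^\dagger XU_{PS}(t)$, $\mathcal{C}_S(X)=SXS$, which satisfy $\frac12\mathcal{U}+\frac12\mathcal{U}^\dagger=\cos^2(gt)\,\mathrm{id}+\sin^2(gt)\,\mathcal{C}_S$. An ontological model of such a fragment consists of a measurable space $\Lambda$, a probability measure $\mu$ on $\Lambda$ (for $\rho$), a Markov kernel $\Gamma_{\mathcal{E}}(d\lambda'|\lambda)$ for each channel $\mathcal{E}$ in the list, with $\Gamma_{\mathrm{id}}(\cdot|\lambda)=\delta_\lambda$, and measurable response functions $\xi_k:\Lambda\to[0,1]$ with $\sum_k\xi_k=1$, such that $\mathrm{Tr}\{E_k\mathcal{E}(\rho)\}=\int_\Lambda\int_\Lambda\xi_k(\lambda')\Gamma_{\mathcal{E}}(d\lambda'|\lambda)d\mu(\lambda)$ for all $k$ and all $\mathcal{E}$ in the list. It is noncontextual if every equality between convex combinations of channels in the list, $\sum_iw_i\mathcal{E}_i=\sum_jv_j\mathcal{F}_j$,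 implies $\sum_iw_i\Gamma_{\mathcal{E}_i}=\sum_jv_j\Gamma_{\mathcal{F}_j}$ (up to sets of measure zero, i.e. for $\mu$-almost every $\lambda$). *)

(* Defs.v *)
From HB Require Import structures.
From mathcomp Require Import all_boot all_order all_algebra.
From mathcomp Require Import spectral.
From mathcomp Require Import all_classical all_reals all_analysis.
From mathcomp Require Import complex mxtens.

Set Implicit Arguments.
Unset Strict Implicit.
Unset Printing Implicit Defensive.
Import Order.TTheory GRing.Theory Num.Theory.
Import numFieldNormedType.Exports.

Local Open Scope classical_set_scope.
Local Open Scope ring_scope.
Local Open Scope complex_scope.
Local Open Scope sesquilinear_scope.

(* The limit is taken in the product topology of the entries. *)
Definition expmx (K : numFieldType) (n : nat) (A : 'M[K]_n) : 'M[K]_n :=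
  limn (series (fun k : nat => (k`!%:R)^-1 *: A ^+ k)).

(* Orthogonal projection on the w-eigenspace of A. The library projections act
   on row vectors; for Hermitian A this is the same matrix as the projection
   acting on column vectors. *)
Definition spectral_proj (C : numClosedFieldType) (n : nat) (A : 'M[C]_n)
    (w : C) : 'M[C]_n :=
  proj_ortho (eigenspace A w).

Definition density_matrix (C : numClosedFieldType) (n : nat) (rho : 'M[C]_n) :
    Prop :=
  [/\ rho ^t* = rho,
      forall v : 'cV[C]_n, 0 <= (v ^t* *m rho *m v) ord0 ord0
    & \tr rho = 1].

Section Ontological.

(* A prepare-transform-measure fragment: one preparation, one measurement with
   outcomes in K, channels labelled by I, i_id being the label of id. *)
Variables (R : realType) (n : nat) (I K : finType).
Variables (rho : 'M[R[i]]_n) (E : K -> 'M[R[i]]_n).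
Variables (chan : I -> 'M[R[i]]_n -> 'M[R[i]]_n) (i_id : I).

Definition convex_weights (w : I -> R) : Prop :=
  (forall i, 0 <= w i) /\ \sum_i w i = 1.

Definition channel_mix (w : I -> R) (X : 'M[R[i]]_n) : 'M[R[i]]_n :=
  \sum_i (w i)%:C *: chan i X.

Variables (disp : measure_display) (L : measurableType disp).
Variables (mu : probability L R) (Gamma : I -> R.-pker L ~> L).
Variable xi : K -> L -> R.

Definition ontological_model : Prop :=
  [/\ forall l (A : set L), measurable A -> Gamma i_id l A = \d_l A,
      forall k, measurable_fun [set: L] (xi k),
      forall k l, 0 <= xi k l <= 1,
      forall l, \sum_k xi k l = 1
    & forall k i,
        (complex.Re (\tr (E k *m chan i rho)))%:E =
        (\int[mu]_l \int[Gamma i l]_l' (xi k l')%:E)%E].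

(* Convex combinations are given by weights on all the labels: a label may
   have weight 0, and the weights of repeated channels add up. *)
Definition noncontextual : Prop :=
  forall w v : I -> R, convex_weights w -> convex_weights v ->
    (forall X, channel_mix w X = channel_mix v X) ->
    {ae mu, forall l, forall A : set L, measurable A ->
      (\sum_i (w i)%:E * Gamma i l A = \sum_i (v i)%:E * Gamma i l A)%E}.

End Ontological.

Definition has_noncontextual_model (R : realType) (n : nat) (I K : finType)
    (rho : 'M[R[i]]_n) (E : K -> 'M[R[i]]_n)
    (chan : I -> 'M[R[i]]_n -> 'M[R[i]]_n) (i_id : I) : Prop :=
  exists (disp : measure_display) (L : measurableType disp)
         (mu : probability L R) (Gamma : I -> R.-pker L ~> L)
         (xi : K -> L -> R),
    ontological_model rho E chan i_id mu Gamma xi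
    /\ noncontextual chan mu Gamma.

Inductive channel_label := ChId | ChU | ChUdag | ChSwap.

Definition channel_label_code (c : channel_label) : nat :=
  match c with ChId => 0 | ChU => 1 | ChUdag => 2 | ChSwap => 3 end.

Definition channel_label_decode (j : nat) : channel_label :=
  match j with 0%N => ChId | 1%N => ChU | 2%N => ChUdag | _ => ChSwap end.

Lemma channel_label_codeK : cancel channel_label_code channel_label_decode.
Proof. by case. Qed.

HB.instance Definition _ := Countable.copy channel_label
  (can_type channel_label_codeK).

Lemma channel_label_enumP : Finite.axiom [:: ChId; ChU; ChUdag; ChSwap].
Proof. by case. Qed.

HB.instance Definition _ := fintype.isFinite.Build channel_label
  channel_label_enumP.

Section HeatFlow.

(* C^d (x) C^d is C^(d * d), with |n,m> the basis vector mxtens_index (n, m). *)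
Variables (R : realType) (d : nat).
Implicit Types (rho X : 'M[R[i]]_(d * d)) (omega : 'I_d -> R).

Definition swapmx : 'M[R[i]]_(d * d) :=
  \sum_(n < d) \sum_(m < d) delta_mx (mxtens_index (m, n)) (mxtens_index (n, m)).

(* The coefficient p_{n,m,n',m'} of |n,m><n',m'|. *)
Definition coef rho (n m n' m' : 'I_d) : R[i] :=
  rho (mxtens_index (n, m)) (mxtens_index (n', m')).

Definition reducedA rho : 'M[R[i]]_d :=
  \matrix_(n, n') \sum_(m < d) coef rho n m n' m.

Definition reducedB rho : 'M[R[i]]_d :=
  \matrix_(m, m') \sum_(n < d) coef rho n m n m'.

(* Both H_A and H_B. *)
Definition hamiltonian omega : 'M[R[i]]_d :=
  \sum_(k < d) (omega k)%:C *: delta_mx k k.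

(* All the omega k are positive where this is used, so the default value 0 of
   the maximum is harmless. *)
Definition omega_max omega : R := \big[Num.max/0]_(k < d) omega k.

Definition gibbs (beta : R) (H : 'M[R[i]]_d) : 'M[R[i]]_d :=
  (\tr (expmx (- beta%:C *: H)))^-1 *: expmx (- beta%:C *: H).

Definition U_PS (g t : R) : 'M[R[i]]_(d * d) :=
  expmx (- ('i%C * (g * t)%:C) *: swapmx).

Definition localA (H : 'M[R[i]]_d) : 'M[R[i]]_(d * d) := tensmx H 1%:M.

(* The trace is real for a density matrix rho. *)
Definition heat omega g rho t : R :=
  complex.Re (\tr (localA (hamiltonian omega) *m
    (U_PS g t *m rho *m (U_PS g t) ^t* - rho))).

Definition nc_inequality omega g rho t : Prop :=
  - 4 * omega_max omega * sin (g * t) ^+ 2 <= heat omega g rho t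
  <= 2 * omega_max omega * sin (g * t) ^+ 2.

Definition F_channel (g t : R) (c : channel_label) X : 'M[R[i]]_(d * d) :=
  match c with
  | ChId => X
  | ChU => U_PS g t *m X *m (U_PS g t) ^t*
  | ChUdag => (U_PS g t) ^t* *m X *m U_PS g t
  | ChSwap => swapmx *m X *m swapmx
  end.

(* Outcomes are the distinct values of omega: degenerate levels share one
   spectral projection. *)
Definition F_effect omega (k : seq_sub (codom omega)) : 'M[R[i]]_(d * d) :=
  spectral_proj (localA (hamiltonian omega)) (ssval k)%:C.

Definition F_noncontextual omega g rho t : Prop :=
  has_noncontextual_model rho (@F_effect omega) (F_channel g t) ChId.

End HeatFlow.

Arguments U_PS {R} d g t.
Arguments swapmx {R} d.

(* Main.v *)
(** Since S^2 = 1, U_PS(t) = cos(gt) - i sin(gt) S, so that the heat is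
    sin^2(gt) (E_B - E_A) - 2 sin(gt) cos(gt) C, where E_A and E_B are the mean
    local energies, C is the sum of the Im(p_{n,m,m,n}) omega_n, and
    |E_B - E_A| <= omega_max.  If C <> 0, the term linear in t breaks one of the
    two bounds for small t; if C = 0, the heat is at most
    omega_max sin^2(gt) in absolute value.  In case (ii) with C = 0 the heat has
    the sign of E_B - E_A, and the Gibbs mean energy decreases with the inverse
    temperature, so that no anomalous flow is possible.

    In a noncontextual model, averaging U and its adjoint gives
    Gamma_U <= 2 cos^2(gt) delta + 2 sin^2(gt) Gamma_S almost everywhere; hence the
    energy response function, with values in [0, omega_max], changes on average
    by at most 2 omega_max sin^2(gt) under Gamma_U. *)

Require Import Defs.
From HB Require Import structures.
From mathcomp Require Import all_boot all_order all_algebra.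
From mathcomp Require Import spectral.
From mathcomp Require Import all_classical all_reals all_analysis.
From mathcomp Require Import measurable_realfun.
From mathcomp Require Import complex mxtens.
From mathcomp Require Import ring lra.

Set Implicit Arguments.
Unset Strict Implicit.
Unset Printing Implicit Defensive.
Import Order.TTheory GRing.Theory Num.Theory.
Import numFieldNormedType.Exports.

Local Open Scope classical_set_scope.
Local Open Scope ring_scope.
Local Open Scope complex_scope.
Local Open Scope sesquilinear_scope.

(** * Matrix exponential *)

(** Uniqueness of limits, which turns convergence of the partial sums into an equation for [expmx].
    Balls of matrices are entrywise, so it suffices to separate one differing entry. *)
Lemma matrix_hausdorff (K : numFieldType) (m n : nat) :
  hausdorff_space 'M[K]_(m, n).
Proof.
rewrite ball_hausdorff => a b ab.
have [i [j abij]] : exists i j, a i j != b i j.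
  apply/not_existsP => eq_ab; case/negP: ab; apply/eqP/matrixP => i j.
  by apply/eqP/negPn/negP => abij; apply: (eq_ab i); exists j.
have := @norm_hausdorff K K; rewrite ball_hausdorff => /(_ _ _ abij)[[r s]] /=.
move=> /eqP rs0; exists (r, s); apply/eqP/seteqP; split=> // z [[_ az] [_ bz]].
have : (ball (a i j) r%:num `&` ball (b i j) s%:num) (z i j) by split.
by rewrite rs0.
Qed.

Lemma cvg_mxP (K : numFieldType) (m n : nat) (u : nat -> 'M[K]_(m, n))
    (l : 'M[K]_(m, n)) :
  (forall i j, (fun k => u k i j) @ \oo --> l i j) -> u @ \oo --> l.
Proof.
move=> ul; apply/cvg_ballP => e e0.
have /filter_forall H : forall i, \forall k \near \oo,
    forall j, ball (l i j) e (u k i j).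
  by move=> i; apply: filter_forall => j; exact: (cvg_ball (ul i j) e0).
by apply: filterS H => k H; split.
Qed.

(** Resolving the identity by the [P i] gives [A ^+ k] as the sum of the [a i ^+ k *: P i], so the
    matrix series splits into scalar exponential series. It serves for both the swap and the
    Hamiltonian. *)
Lemma expmx_spectral (K : numFieldType) (n : nat) (I : finType) (A : 'M[K]_n)
    (a e : I -> K) (P : I -> 'M[K]_n) :
  \sum_i P i = 1 -> (forall i, A *m P i = a i *: P i) ->
  (forall i, series (fun k => (k`!%:R)^-1 * a i ^+ k) @ \oo --> e i) ->
  expmx A = \sum_i e i *: P i.
Proof.
move=> P1 AP aexp.
have Apow k : A ^+ k = \sum_i a i ^+ k *: P i.
  elim: k => [|k IHk].
    by rewrite expr0 -P1; apply: eq_bigr => i _; rewrite expr0 scale1r.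
  rewrite exprS IHk mulr_sumr; apply: eq_bigr => i _.
  by rewrite exprSr -scalerA -AP scalemxAr.
apply: cvg_lim; first exact: matrix_hausdorff.
have -> : series (fun k => (k`!%:R)^-1 *: A ^+ k) =
    fun N => \sum_i series (fun k => (k`!%:R)^-1 * a i ^+ k) N *: P i.
  apply/funext => N; rewrite /series /=.
  under eq_bigr do rewrite Apow scaler_sumr.
  rewrite exchange_big /=; apply: eq_bigr => i _.
  by rewrite scaler_suml; apply: eq_bigr => k _; rewrite scalerA.
apply: cvg_mxP => i j; rewrite summxE.
under eq_cvg do rewrite summxE.
apply: cvg_big; first by move=> x; exact: add_continuous.
move=> k _; rewrite mxE; under eq_cvg do rewrite mxE.
exact: cvgMr_tmp (aexp k).
Qed.

(* The topology of a numFieldType is only inferred for terms whose type is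
   displayed as such, hence this name for R[i]. *)
Definition complex_field (R : realType) : numFieldType := R[i].

Lemma cvg_complex (R : realType) (x y : nat -> R) (a b : R) :
  x @ \oo --> a -> y @ \oo --> b ->
  (fun k => (x k)%:C + 'i%C * (y k)%:C : complex_field R) @ \oo -->
    (a%:C + 'i%C * b%:C : complex_field R).
Proof.
have real_cvg (z : nat -> R) (c : R) : z @ \oo --> c ->
    (fun k => (z k)%:C : complex_field R) @ \oo --> (c%:C : complex_field R).
  move=> zc; apply/cvgrPdist_lt => e e0.
  (* A positive element of [R[i]] is real, so its real part can serve as the radius for the real
     limit. *)
  have /cvgrPdist_lt/(_ (complex.Re e)) zc' := zc.
  have eE : e = (complex.Re e)%:C by rewrite RRe_real// gtr0_real.
  have Re0 : 0 < complex.Re e by rewrite -ltcR -eE.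
  apply: filterS (zc' Re0) => k.
  by rewrite -raddfB /= normc_def /= expr0n /= addr0 sqrtr_sqr eE ltcR.
move=> xa yb; apply: cvgD; first exact: real_cvg.
by apply: cvgMl_tmp; exact: real_cvg.
Qed.

Lemma expC_real (R : realType) (x : R) :
  series (fun k => (k`!%:R)^-1 * (x%:C : complex_field R) ^+ k) @ \oo -->
    ((expR x)%:C : complex_field R).
Proof.
have cvg0 : (fun=> 0 : R) @ \oo --> (0 : R) by exact: cvg_cst.
have := cvg_complex (@is_cvg_series_exp_coeff R x) cvg0.
rewrite mulr0 addr0 -/(expR x).
apply: cvg_trans; apply: near_eq_cvg; apply: nearW => N; apply/esym.
rewrite addr0 /series /= rmorph_sum.
apply: eq_bigr => k _ /=; rewrite /exp_coeff /= rmorphM rmorphXn mulrC.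
by rewrite fmorphV rmorph_nat.
Qed.

(** Euler's formula, proved term by term: even powers of the imaginary unit give the cosine
    coefficients, odd powers the sine coefficients. *)
Lemma expC_imaginary (R : realType) (x : R) :
  series (fun k => (k`!%:R)^-1 * ('i%C * x%:C : complex_field R) ^+ k) @ \oo -->
    ((cos x)%:C + 'i%C * (sin x)%:C : complex_field R).
Proof.
rewrite cos.unlock sin.unlock.
have := cvg_complex (@is_cvg_series_cos_coeff R x) (@is_cvg_series_sin_coeff R x).
apply: cvg_trans; apply: near_eq_cvg; apply: nearW => N; apply/esym.
rewrite /series /= !rmorph_sum mulr_sumr -big_split.
apply: eq_bigr => k _ /=; rewrite /cos_coeff /sin_coeff /=.
rewrite exprMn !rmorphM !rmorphXn /= !fmorphV !rmorph_nat.
(* The exponent [k.-1./2] equals [k./2] for odd [k]; for even [k] its term vanishes. This is the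
   shape of [sin_coeff]. *)
have -> : 'i%C ^+ k = (~~ odd k)%:R * (-1) ^+ k./2 +
   'i%C * ((odd k)%:R * (-1) ^+ k.-1./2) :> R[i].
  rewrite -[in LHS](odd_double_half k) exprD.
  have -> : 'i%C ^+ (k./2).*2 = (-1) ^+ k./2 :> R[i].
    by rewrite -mul2n exprM sqr_i.
  case: (boolP (odd k)) => ok /=; last by rewrite expr0 !mul1r !mul0r mulr0 addr0.
  rewrite expr1 !mul0r add0r mul1r.
  by congr (_ * _ ^+ _); case: k ok => //= k ok; rewrite uphalf_half (negbTE ok).
by rewrite rmorphN1; ring.
Qed.

(** * Energy change in an ontological model *)

Section KernelMixture.
Local Open Scope ereal_scope.
Context (disp : measure_display) (L : measurableType disp) (R : realType).

(* As h vanishes at l, the Dirac part of the mixture does not contribute. *)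
Lemma integral_dominated_mixture (U V S : {measure set L -> \bar R}) (l : L)
    (a b c : R) (h : L -> R) (M : R) :
  (0 <= a)%R -> (0 <= b)%R -> (0 <= c)%R ->
  U [set: L] = 1 -> S [set: L] = 1 ->
  (forall A, measurable A ->
     a%:E * U A + a%:E * V A = b%:E * \d_l A + c%:E * S A) ->
  measurable_fun [set: L] h -> (forall x, 0 <= h x <= M)%R -> h l = 0%R ->
  a%:E * \int[U]_x (h x)%:E <= (c * M)%:E.
Proof.
move=> a0 b0 c0 UT ST UVS mh hM hl.
have mhE : measurable_fun [set: L] (fun x => (h x)%:E).
  exact/measurable_EFinP.
have h0 x : [set: L] x -> 0 <= (h x)%:E.
  by move=> _; rewrite lee_fin; case/andP: (hM x).
have eq_int := @eq_measure_integral _ L R [set: L]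
  (measure_add (mscale (NngNum b0) \d_l) (mscale (NngNum c0) S))
  (measure_add (mscale (NngNum a0) U) (mscale (NngNum a0) V)) (fun x => (h x)%:E).
have {eq_int} := eq_int.
rewrite !ge0_integral_measure_add// !ge0_integral_mscale//=.
rewrite integral_dirac// diracT mul1e /= hl mule0 add0e => eq_int.
(* Discard the nonnegative [V] integral, then bound [h] by [M] under the probability [S]. *)
apply: (@le_trans _ _ (c%:E * \int[S]_x (h x)%:E)).
  rewrite -[leRHS]eq_int; last first.
    move=> A mA _; rewrite /measure_add /= /msum !big_ord_recl !big_ord0 /=.
    by rewrite !adde0 /mscale /= UVS.
  by rewrite leeDl// mule_ge0// ?lee_fin//; exact: integral_ge0.
rewrite EFinM lee_wpmul2l ?lee_fin//.
apply: (@le_trans _ _ (\int[S]_(x in [set: L]) M%:E)).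
  by apply: ge0_le_integral => // x _; rewrite lee_fin; case/andP: (hM x).
by rewrite integral_cst// [X in _ * X]ST mule1.
Qed.

(** For [a > 0] this says that the mean of [f] under [U] is within [c * M / a] of [f l]. The two
    additive inequalities avoid subtraction in the extended reals. *)
Lemma integral_mixture_le (U V S : {measure set L -> \bar R}) (l : L)
    (a b c : R) (f : L -> R) (M : R) :
  (0 <= a)%R -> (0 <= b)%R -> (0 <= c)%R ->
  U [set: L] = 1 -> S [set: L] = 1 ->
  (forall A, measurable A ->
     a%:E * U A + a%:E * V A = b%:E * \d_l A + c%:E * S A) ->
  measurable_fun [set: L] f -> (forall x, 0 <= f x <= M)%R ->
  a%:E * \int[U]_x (f x)%:E <= (a * f l + c * M)%:E /\
  (a * f l)%:E <= a%:E * \int[U]_x (f x)%:E + (c * M)%:E.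
Proof.
move=> a0 b0 c0 UT ST UVS mf fM.
have f0 x : (0 <= f x)%R by case/andP: (fM x).
have fleM x : (f x <= M)%R by case/andP: (fM x).
(* f differs from its value at l by at most the functions up and dn, which both
   vanish at l. *)
pose up x := Num.max (f x - f l)%R 0%R; pose dn x := Num.max (f l - f x)%R 0%R.
have mup : measurable_fun [set: L] up.
  by apply: measurable_maxr => //; exact: measurable_funB.
have mdn : measurable_fun [set: L] dn.
  by apply: measurable_maxr => //; exact: measurable_funB.
have Hup : (forall x, 0 <= up x <= M)%R.
  move=> x; rewrite /up le_max lexx orbT ge_max.
  by have := f0 x; have := fleM x; have := f0 l; lra.
have Hdn : (forall x, 0 <= dn x <= M)%R.
  move=> x; rewrite /dn le_max lexx orbT ge_max.
  by have := f0 x; have := fleM l; have := f0 l; lra.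
have bound h := @integral_dominated_mixture U V S l a b c h M a0 b0 c0 UT ST UVS.
have dominate (p q h : L -> R) : (forall x, 0 <= p x)%R ->
    (forall x, 0 <= q x)%R -> measurable_fun [set: L] p ->
    measurable_fun [set: L] q -> measurable_fun [set: L] h ->
    (forall x, 0 <= h x <= M)%R -> h l = 0%R ->
    (forall x, p x <= q x + h x)%R ->
    a%:E * \int[U]_x (p x)%:E <= a%:E * \int[U]_x (q x)%:E + (c * M)%:E.
  move=> p0 q0 mp mq mh hM hl pqh.
  apply: le_trans (leeD2l _ (bound h mh hM hl)).
  rewrite -ge0_muleDr ?integral_ge0//; last 2 first.
  - by move=> x _; rewrite lee_fin.
  - by move=> x _; rewrite lee_fin; case/andP: (hM x).
  rewrite lee_wpmul2l ?lee_fin// -ge0_integralD//; last 4 first.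
  - by move=> x _; rewrite lee_fin.
  - exact/measurable_EFinP.
  - by move=> x _; rewrite lee_fin; case/andP: (hM x).
  - exact/measurable_EFinP.
  apply: ge0_le_integral => //.
  - by move=> x _; rewrite lee_fin.
  - exact/measurable_EFinP.
  - by apply: emeasurable_funD; exact/measurable_EFinP.
  - by move=> x _; rewrite -EFinD lee_fin.
have int_cst (r : R) : \int[U]_x (cst r x)%:E = r%:E.
  rewrite (@integral_cst _ _ _ U setT measurableT r%:E).
  by rewrite [X in _ * X]UT mule1.
split.
- rewrite EFinD EFinM -(int_cst (f l)).
  have fl0 (x : L) : (0 <= cst (f l) x)%R by exact: f0.
  apply: (@dominate f (cst (f l)) up) => //.
    by rewrite /up subrr maxxx.
  by move=> x /=; rewrite /up -lerBlDl le_max lexx.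
- rewrite EFinM -[X in _ * X](int_cst (f l)).
  have fl0 (x : L) : (0 <= cst (f l) x)%R by exact: f0.
  apply: (@dominate (cst (f l)) f dn) => //.
    by rewrite /dn subrr maxxx.
  by move=> x /=; rewrite /dn -lerBlDl le_max lexx.
Qed.

End KernelMixture.

Section OntologicalEnergy.
Context (R : realType) (n : nat) (I K : finType).
Context (rho : 'M[R[i]]_n) (E : K -> 'M[R[i]]_n).
Context (chan : I -> 'M[R[i]]_n -> 'M[R[i]]_n) (i_id : I).
Context (disp : measure_display) (L : measurableType disp).
Context (mu : probability L R) (Gamma : I -> R.-pker L ~> L) (xi : K -> L -> R).
Hypothesis model : ontological_model rho E chan i_id mu Gamma xi.
Context (val : K -> R) (M : R).
Hypothesis val_ge0 : forall k, 0 <= val k.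
Hypothesis val_le : forall k, val k <= M.

Let energy (j : I) : R := \sum_k val k * complex.Re (\tr (E k *m chan j rho)).
Let value (l : L) : R := \sum_k val k * xi k l.

Let value_ge0 l : 0 <= value l.
Proof.
have [_ _ xi01 _ _] := model.
by apply: sumr_ge0 => k _; rewrite mulr_ge0//; case/andP: (xi01 k l).
Qed.

Let value_le l : value l <= M.
Proof.
have [_ _ xi01 xi1 _] := model.
rewrite -[leRHS]mulr1 -(xi1 l) mulr_sumr; apply: ler_sum => k _.
by rewrite ler_wpM2r//; case/andP: (xi01 k l).
Qed.

Let measurable_value : measurable_fun [set: L] value.
Proof.
have [_ mxi _ _ _] := model.
apply: measurable_sum => k.
by apply: measurable_funM; [exact: measurable_cst | exact: mxi].
Qed.

Let energyE (j : I) :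
  (energy j)%:E = (\int[mu]_l \int[Gamma j l]_x (value x)%:E)%E.
Proof.
have [_ mxi xi01 _ stat] := model.
have xi0 k l : 0 <= xi k l by case/andP: (xi01 k l).
have mxiE k : measurable_fun [set: L] (fun x => (xi k x)%:E).
  by apply/measurable_EFinP; exact: mxi.
have xiE0 k x : [set: L] x -> (0 <= (xi k x)%:E)%E by rewrite lee_fin.
have mint k : measurable_fun [set: L] (fun l => \int[Gamma j l]_x (xi k x)%:E)%E.
  apply: (@measurable_fun_integral_kernel _ _ _ _ R (Gamma j)).
  - by move=> U mU; exact: measurable_kernel.
  - by move=> z; exact: xiE0.
  - exact: mxiE.
have inner l : (\int[Gamma j l]_x (value x)%:E =
    \sum_k (val k)%:E * \int[Gamma j l]_x (xi k x)%:E)%E.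
  under eq_integral do rewrite /value -sumEFin.
  rewrite (@ge0_integral_sum _ _ _ (Gamma j l) _ measurableT K
    (fun k x => (val k * xi k x)%:E)).
  - by apply: eq_bigr => k _; rewrite -ge0_integralZl_EFin// => x; exact: xiE0.
  - by move=> k; apply/measurable_EFinP; apply: measurable_funM;
      [exact: measurable_cst | exact: mxi].
  - by move=> k x _; rewrite lee_fin mulr_ge0.
under [RHS]eq_integral do rewrite inner.
rewrite (@ge0_integral_sum _ _ _ mu _ measurableT K
  (fun k l => (val k)%:E * \int[Gamma j l]_x (xi k x)%:E)%E); last 2 first.
- by move=> k; apply: emeasurable_funM; [exact: measurable_cst | exact: mint].
- move=> k x _; rewrite mule_ge0 ?lee_fin//.
  by apply: integral_ge0 => y; exact: xiE0.
rewrite -sumEFin; apply: eq_bigr => k _; rewrite EFinM stat.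
rewrite ge0_integralZl_EFin// => l _.
by apply: integral_ge0 => y; exact: xiE0.
Qed.

(** For almost every ontic state [l], [integral_mixture_le] keeps the mean of [value] under
    [Gamma iU l] close to [value l]; integrating over [mu] bounds the change of the observed
    mean. *)
Lemma energy_change_le (a b c : R) (iU iV iS : I) :
  0 < a -> 0 <= b -> 0 <= c ->
  {ae mu, forall l, forall A : set L, measurable A ->
    (a%:E * Gamma iU l A + a%:E * Gamma iV l A =
     b%:E * Gamma i_id l A + c%:E * Gamma iS l A)%E} ->
  a * `|energy iU - energy i_id| <= c * M.
Proof.
move=> a0 b0 c0 mix; have [delta _ _ _ _] := model.
have energy_id : (energy i_id)%:E = (\int[mu]_l (value l)%:E)%E.
  rewrite energyE; apply: eq_integral => l _.
  rewrite (@eq_measure_integral _ _ _ _ \d_l).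
    by rewrite integral_dirac ?diracT ?mul1e//; exact/measurable_EFinP.
  by move=> A mA _; exact: delta.
have bounds : {ae mu, forall l, (a%:E * \int[Gamma iU l]_x (value x)%:E <=
      (a * value l + c * M)%:E /\
    (a * value l)%:E <= a%:E * \int[Gamma iU l]_x (value x)%:E + (c * M)%:E)%E}.
  apply: filterS mix => l mixl.
  apply: (@integral_mixture_le _ _ _ (Gamma iU l) (Gamma iV l) (Gamma iS l) l
    a b c value M) => //.
  - exact: (ltW a0).
  - exact: prob_kernel.
  - exact: prob_kernel.
  - by move=> A mA; rewrite mixl// delta.
  - by move=> x; rewrite value_ge0 value_le.
(* A space of total mass 1 has a point, and [value] lies between 0 and [M] there. *)
have M0 : 0 <= M.
  have /set0P[l _] : [set: L] != set0.
    apply/eqP => L0; have := @probability_setT _ _ _ mu; rewrite L0 measure0.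
    by move/eqP; rewrite eq_sym onee_eq0.
  exact: le_trans (value_ge0 l) (value_le l).
have mvalE : measurable_fun [set: L] (fun l => (value l)%:E).
  exact/measurable_EFinP.
have mU : measurable_fun [set: L] (fun l => \int[Gamma iU l]_x (value x)%:E)%E.
  apply: (@measurable_fun_integral_kernel _ _ _ _ R (Gamma iU)) => //.
  by move=> U mU; exact: measurable_kernel.
have U0 l : (0 <= \int[Gamma iU l]_x (value x)%:E)%E.
  by apply: integral_ge0 => x _; rewrite lee_fin.
have cM0 : 0 <= c * M by rewrite mulr_ge0.
have a0' := ltW a0.
have shift (F : L -> \bar R) (e : R) : (forall l, 0 <= F l)%E ->
    measurable_fun [set: L] F -> e%:E = (\int[mu]_l F l)%E ->
    (\int[mu]_l (a%:E * F l + (c * M)%:E) = (a * e + c * M)%:E)%E.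
  move=> F0 mF eF.
  rewrite ge0_integralD//; last 2 first.
  - by move=> l _; rewrite mule_ge0.
  - by apply: emeasurable_funM => //; exact: measurable_cst.
  rewrite (@integral_cst _ _ _ mu setT measurableT (c * M)%:E).
  rewrite [X in (_ + _ * X)%E](probability_setT mu) mule1.
  by rewrite ge0_integralZl_EFin// -eF.
have scale (F : L -> \bar R) (e : R) : (forall l, 0 <= F l)%E ->
    measurable_fun [set: L] F -> e%:E = (\int[mu]_l F l)%E ->
    (\int[mu]_l (a%:E * F l) = (a * e)%:E)%E.
  by move=> F0 mF eF; rewrite ge0_integralZl_EFin// -eF.
(* The two halves of [bounds] are both of this form, with the roles of [F] and [G] exchanged. *)
have le_energy (F G : L -> \bar R) (e e' : R) :
    (forall l, 0 <= F l)%E -> (forall l, 0 <= G l)%E ->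
    measurable_fun [set: L] F -> measurable_fun [set: L] G ->
    e%:E = (\int[mu]_l F l)%E -> e'%:E = (\int[mu]_l G l)%E ->
    {ae mu, forall l, (a%:E * F l <= a%:E * G l + (c * M)%:E)%E} ->
    a * e <= a * e' + c * M.
  move=> F0 G0 mF mG eF eG FG.
  rewrite -lee_fin -(scale _ _ F0 mF eF) -(shift _ _ G0 mG eG).
  have maF H : measurable_fun [set: L] H ->
      measurable_fun [set: L] (fun l => a%:E * H l)%E.
    by move=> mH; apply: emeasurable_funM => //; exact: measurable_cst.
  apply: ae_ge0_le_integral => //.
  - by move=> l _; rewrite mule_ge0.
  - exact: maF.
  - by move=> l _; rewrite adde_ge0// mule_ge0.
  - by apply: emeasurable_funD => //; exact: maF.
  - by apply: filterS FG.
have val0 l : (0 <= (value l)%:E)%E by rewrite lee_fin.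
rewrite -[a in leLHS]gtr0_norm// -normrM ler_norml mulrBr.
have upper : a * energy iU <= a * energy i_id + c * M.
  apply: (le_energy _ _ _ _ U0 val0 mU mvalE (energyE iU) energy_id).
  by apply: filterS bounds => l []; rewrite EFinD EFinM.
have lower : a * energy i_id <= a * energy iU + c * M.
  apply: (le_energy _ _ _ _ val0 U0 mvalE mU energy_id (energyE iU)).
  by apply: filterS bounds => l []; rewrite [(a * value l)%:E]EFinM.
by move: upper lower; lra.
Qed.

End OntologicalEnergy.

(** * Swap dynamics *)

(** A basis vector with eigenvalue [w] lies in the eigenspace and is fixed. Any other basis vector
    is orthogonal to it, because eigenvectors for [w] vanish at that coordinate. *)
Lemma spectral_proj_diag (C : numClosedFieldType) (n : nat) (a : 'rV[C]_n)
    (w : C) :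
  spectral_proj (diag_mx a) w = diag_mx (\row_i (a 0 i == w)%:R).
Proof.
apply/row_matrixP => i; rewrite row_diag_mx mxE rowE.
have [aiw|aiNw] := eqVneq (a 0 i) w.
  rewrite scale1r proj_ortho_id//; apply/eigenspaceP.
  by rewrite -rowE row_diag_mx aiw.
rewrite scale0r proj_ortho_0//; apply/orthomx1P.
rewrite -rowE; apply/rowP => j; rewrite !mxE.
have /eigenspaceP/matrixP/(_ j i) := submx_refl (eigenspace (diag_mx a) w).
rewrite mul_mx_diag !mxE mulrC => /eqP; rewrite -subr_eq0 -mulrBl mulf_eq0.
by rewrite subr_eq0 (negbTE aiNw) /= => /eqP ->; rewrite conjC0.
Qed.

Section ComplexParts.
Variable R : realType.
Implicit Types z : R[i].

Lemma Re_sum (I : finType) (F : I -> R[i]) :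
  complex.Re (\sum_i F i) = \sum_i complex.Re (F i).
Proof. by apply: (big_morph (@complex.Re R)) => // -[? ?] [? ?]. Qed.

Lemma Re_realM (x : R) z : complex.Re (x%:C * z) = x * complex.Re z.
Proof. by case: z => a b /=; rewrite mul0r subr0. Qed.

End ComplexParts.

Section Swap.
Variables (R : realType) (d : nat).
Implicit Types (X : 'M[R[i]]_(d * d)) (omega : 'I_d -> R).

Definition swap_idx (i : 'I_(d * d)) : 'I_(d * d) :=
  mxtens_index ((mxtens_unindex i).2, (mxtens_unindex i).1).

Lemma swap_idxE n m : swap_idx (mxtens_index (n, m)) = mxtens_index (m, n).
Proof. by rewrite /swap_idx mxtens_indexK. Qed.

Lemma swap_idxK : involutive swap_idx.
Proof. by move=> i; case: (mxtens_indexP i) => n m; rewrite !swap_idxE. Qed.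

Lemma sum_mxtens (V : nmodType) (F : 'I_d -> 'I_d -> V) :
  \sum_n \sum_m F n m =
  \sum_(i < d * d) F (mxtens_unindex i).1 (mxtens_unindex i).2.
Proof.
rewrite pair_bigA /=; apply: (reindex (@mxtens_unindex d d)).
exists (@mxtens_index d d) => x _; first exact: mxtens_unindexK.
exact: mxtens_indexK.
Qed.

Lemma swapmxE i j : swapmx d i j = (i == swap_idx j)%:R :> R[i].
Proof.
rewrite /swapmx sum_mxtens summxE (bigD1 j)// big1.
  by rewrite Monoid.mulm1 mxE -surjective_pairing mxtens_unindexK eqxx andbT.
move=> k /= kj; rewrite mxE -[X in _ && X]/(j == mxtens_index (mxtens_unindex k)).
rewrite mxtens_unindexK.
by rewrite [j == k]eq_sym (negbTE kj) andbF.
Qed.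

Lemma mulmx_swapE X i j : (X *m swapmx d) i j = X i (swap_idx j).
Proof.
rewrite mxE (bigD1 (swap_idx j))//= swapmxE eqxx mulr1 big1 ?addr0// => k kj.
by rewrite swapmxE (negbTE kj) mulr0.
Qed.

Lemma swap_mulmxE X i j : (swapmx d *m X) i j = X (swap_idx i) j.
Proof.
rewrite mxE (bigD1 (swap_idx i))//= swapmxE swap_idxK eqxx mul1r.
rewrite big1 ?addr0// => k kj; rewrite swapmxE; case: eqP => [ik|_]; last first.
  by rewrite mul0r.
by rewrite ik swap_idxK eqxx in kj.
Qed.

Lemma swapmxK : swapmx d *m swapmx d = 1%:M :> 'M[R[i]]_(d * d).
Proof.
apply/matrixP => i j; rewrite mulmx_swapE swapmxE swap_idxK !mxE.
by [].
Qed.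

Lemma swapmx_hermitian : (swapmx d) ^t* = swapmx d :> 'M[R[i]]_(d * d).
Proof.
apply/matrixP => i j; rewrite !mxE !swapmxE conjC_nat.
by rewrite -(inj_eq (can_inj swap_idxK)) swap_idxK eq_sym.
Qed.

(** As the swap squares to 1, half of 1 plus or minus the swap gives the projections on symmetric
    and antisymmetric vectors, and the exponential acts on each by a phase. *)
Lemma U_PSE (g t : R) :
  U_PS d g t = (cos (g * t))%:C *: 1%:M - ('i%C * (sin (g * t))%:C) *: swapmx d.
Proof.
set th := g * t.
(* The boolean indexes the two eigenvalues of the swap: [false] is the symmetric part, [true] the
   antisymmetric one. *)
pose s (b : bool) : R[i] := (-1) ^+ b.
pose P b : 'M[R[i]]_(d * d) := 2^-1 *: (1%:M + s b *: swapmx d).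
pose a b : R[i] := 'i%C * (- (-1) ^+ b * th)%:C.
pose e b : R[i] := (cos (- (-1) ^+ b * th))%:C + 'i%C * (sin (- (-1) ^+ b * th))%:C.
rewrite /U_PS (@expmx_spectral _ _ bool _ a e P).
- rewrite big_bool /= /e /P /s expr0 expr1 !mulN1r opprK mul1r.
  rewrite cosN sinN !scalerA !scalerDr !scalerA rmorphN /=.
  have h2 : (2 : R[i]) != 0 by rewrite pnatr_eq0.
  rewrite addrACA -scalerDl -scalerDl -scaleNr.
  by congr (_ *: _ + _ *: _); field.
- have h2 : (2 : R[i]) != 0 by rewrite pnatr_eq0.
  rewrite big_bool /= /P /s expr0 expr1 -scalerDr addrACA scaleN1r scale1r.
  rewrite addNr addr0 scalerDr -scalerDl.
  have -> : 2^-1 + 2^-1 = 1 :> R[i] by field.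
  by rewrite scale1r.
- move=> b; have SP : swapmx d *m P b = s b *: P b.
    rewrite /P -scalemxAr mulmxDr mulmx1 -scalemxAr swapmxK.
    rewrite [RHS]scalerA [in RHS]mulrC -[RHS]scalerA; congr (_ *: _).
    by rewrite scalerDr scalerA -expr2 sqrr_sign scale1r addrC.
  rewrite -scalemxAl SP scalerA; congr (_ *: _).
  by rewrite /a /s; case: b {SP}; rewrite ?expr0 ?expr1;
    rewrite !(rmorphM, rmorphN, rmorph1) /=; ring.
- by move=> b; exact: expC_imaginary.
Qed.

Lemma U_PS_adjE (g t : R) :
  (U_PS d g t) ^t* =
    (cos (g * t))%:C *: 1%:M + ('i%C * (sin (g * t))%:C) *: swapmx d.
Proof.
rewrite U_PSE linearB map_mxB !linearZ /= !map_mxZ trmx1 map_mx1 swapmx_hermitian.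
rewrite rmorphM /= -scaleNr -mulNr; congr (_ *: _ + _ *: _).
- by apply/eqP; rewrite eq_complex /= oppr0 !eqxx.
- by apply/eqP; rewrite eq_complex /=; apply/andP; split; apply/eqP; ring.
Qed.

(** Keeping [z] arbitrary covers both unitary channels, which correspond to opposite values of [z].
    Only the commutator term changes sign, so it cancels in their average. *)
Lemma swap_conjugation (c z : R[i]) X :
  (c *: 1%:M - z *: swapmx d) *m X *m (c *: 1%:M + z *: swapmx d) =
    c ^+ 2 *: X - z ^+ 2 *: (swapmx d *m X *m swapmx d) +
    (c * z) *: (X *m swapmx d - swapmx d *m X).
Proof.
rewrite mulmxBl -!scalemxAl mul1mx mulmxDr -!scalemxAr mulmx1 mulmxBl -!scalemxAl.
move: (swapmx d *m X) (X *m swapmx d) => SX XS.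
move: (SX *m swapmx d) => SXS.
by apply/matrixP => i j; rewrite !mxE; ring.
Qed.

Lemma sqr_imaginary (x : R) : ('i%C * x%:C) ^+ 2 = - (x ^+ 2)%:C :> R[i].
Proof. by rewrite exprMn sqr_i mulN1r rmorphXn. Qed.

Lemma F_channelUE (g t : R) X :
  F_channel g t ChU X = (cos (g * t) ^+ 2)%:C *: X +
    (sin (g * t) ^+ 2)%:C *: (swapmx d *m X *m swapmx d) +
    ('i%C * (cos (g * t) * sin (g * t))%:C) *: (X *m swapmx d - swapmx d *m X).
Proof.
rewrite /= U_PS_adjE U_PSE swap_conjugation sqr_imaginary scaleNr opprK.
by rewrite !rmorphXn; congr (_ + _ *: _); rewrite rmorphM /= mulrCA.
Qed.

Lemma F_channelUdagE (g t : R) X :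
  F_channel g t ChUdag X = (cos (g * t) ^+ 2)%:C *: X +
    (sin (g * t) ^+ 2)%:C *: (swapmx d *m X *m swapmx d) -
    ('i%C * (cos (g * t) * sin (g * t))%:C) *: (X *m swapmx d - swapmx d *m X).
Proof.
rewrite /= U_PS_adjE U_PSE.
have := swap_conjugation (cos (g * t))%:C (- ('i%C * (sin (g * t))%:C)) X.
rewrite !scaleNr opprK => ->; rewrite sqrrN sqr_imaginary scaleNr opprK.
rewrite mulrN scaleNr.
by rewrite !rmorphXn; congr (_ - _ *: _); rewrite rmorphM /= mulrCA.
Qed.

Lemma hamiltonian_diag omega :
  hamiltonian omega = diag_mx (\row_k (omega k)%:C).
Proof. by rewrite diag_mx_sum_delta; apply: eq_bigr => k _; rewrite mxE. Qed.

Lemma localA_hamiltonianE omega :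
  localA (hamiltonian omega) =
    diag_mx (\row_i (omega (mxtens_unindex i).1)%:C).
Proof.
rewrite hamiltonian_diag; apply/matrixP => i j; case: (mxtens_indexP i) => n m.
case: (mxtens_indexP j) => n' m'; rewrite tensmxE !mxE !mxtens_indexK /=.
rewrite (inj_eq (can_inj (@mxtens_indexK d d))) xpair_eqE.
by rewrite mulr_natr -mulrnA mulnb.
Qed.

Lemma Re_tr_diag (n : nat) (w : 'I_n -> R) (Y : 'M[R[i]]_n) :
  complex.Re (\tr (diag_mx (\row_i (w i)%:C) *m Y)) =
    \sum_i w i * complex.Re (Y i i).
Proof.
rewrite /mxtrace Re_sum; apply: eq_bigr => i _.
by rewrite mul_diag_mx !mxE Re_realM.
Qed.

(** The Hamiltonian is recovered from its spectral projections: each diagonal entry of [X] is picked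
    up by exactly one outcome, its own energy level [k0]. *)
Lemma energy_effects omega X :
  \sum_(k : seq_sub (codom omega))
     ssval k * complex.Re (\tr (F_effect k *m X)) =
  complex.Re (\tr (localA (hamiltonian omega) *m X)).
Proof.
rewrite localA_hamiltonianE Re_tr_diag.
under eq_bigr => k _.
  rewrite /F_effect localA_hamiltonianE spectral_proj_diag.
  rewrite (_ : diag_mx _ =
    diag_mx (\row_i (omega (mxtens_unindex i).1 == ssval k)%:R%:C)).
    rewrite Re_tr_diag mulr_sumr; over.
  congr diag_mx; apply/rowP => i; rewrite !mxE (inj_eq (@complexI R)).
  by rewrite rmorph_nat.
rewrite exchange_big /=; apply: eq_bigr => i _.
pose k0 := SeqSub (codom_f omega (mxtens_unindex i).1).
rewrite (bigD1 k0)//= eqxx mul1r big1 ?addr0// => k kk0.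
case: eqP => [E|_]; last by rewrite mul0r mulr0.
by case/eqP: kk0; apply/val_inj.
Qed.

End Swap.

(** * Heat flow *)

Section HeatExpansion.
Variables (R : realType) (d : nat).
Implicit Types (rho : 'M[R[i]]_(d * d)) (omega : 'I_d -> R).

Definition energyA omega rho : R :=
  \sum_(n < d) \sum_(m < d) omega n * complex.Re (coef rho n m n m).

Definition energyB omega rho : R :=
  \sum_(n < d) \sum_(m < d) omega n * complex.Re (coef rho m n m n).

Definition coherence omega rho : R :=
  \sum_(n < d) \sum_(m < d) complex.Im (coef rho n m m n) * omega n.

(** On the diagonal, the swapped term exchanges the populations of A and B. The commutator gives an
    entry minus its conjugate, by hermiticity, hence the imaginary parts in [coherence]. *)
Lemma heatE omega g rho t : rho ^t* = rho ->
  heat omega g rho t = sin (g * t) ^+ 2 * (energyB omega rho - energyA omega rho)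
    - 2 * sin (g * t) * cos (g * t) * coherence omega rho.
Proof.
move=> rhoH; rewrite /heat -/(F_channel g t ChU rho).
rewrite localA_hamiltonianE Re_tr_diag.
rewrite /energyA /energyB /coherence !sum_mxtens.
rewrite -sumrB !mulr_sumr -sumrB; apply: eq_bigr => i _.
have rho_swap : rho (swap_idx i) i = conjc (rho i (swap_idx i)).
  by rewrite -[in LHS]rhoH !mxE.
have -> : coef rho (mxtens_unindex i).1 (mxtens_unindex i).2
    (mxtens_unindex i).1 (mxtens_unindex i).2 = rho i i.
  by rewrite /coef -surjective_pairing mxtens_unindexK.
have -> : coef rho (mxtens_unindex i).2 (mxtens_unindex i).1
    (mxtens_unindex i).2 (mxtens_unindex i).1 = rho (swap_idx i) (swap_idx i).
  by [].
have -> : coef rho (mxtens_unindex i).1 (mxtens_unindex i).2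
    (mxtens_unindex i).2 (mxtens_unindex i).1 = rho i (swap_idx i).
  by rewrite /coef -surjective_pairing mxtens_unindexK.
rewrite F_channelUE.
have := mulmx_swapE (swapmx d *m rho) i i; rewrite swap_mulmxE.
have := mulmx_swapE rho i i; have := swap_mulmxE rho i i; rewrite rho_swap.
move: (swapmx d *m rho *m swapmx d) => SrS.
move: (swapmx d *m rho) (rho *m swapmx d) => Sr rS SrE rSE SrSE.
rewrite !mxE SrE rSE SrSE.
have := cos2Dsin2 (g * t).
case: (rho i i) (rho i (swap_idx i)) (rho (swap_idx i) (swap_idx i)).
move=> a a' [b b'] [e e'] cs /=.
have -> : cos (g * t) ^+ 2 = 1 - sin (g * t) ^+ 2 by rewrite -cs; ring.
ring.
Qed.

Lemma density_diag_ge0 rho i : density_matrix rho -> 0 <= complex.Re (rho i i).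
Proof.
case=> _ + _ => /(_ (delta_mx i 0)).
have -> : (delta_mx i 0 : 'cV[R[i]]_(d * d)) ^t* = delta_mx 0 i.
  by rewrite trmx_delta map_delta_mx.
by rewrite -rowE -colE !mxE lecE => /andP[].
Qed.

End HeatExpansion.

Lemma sum_channel (V : nmodType) (F : channel_label -> V) :
  \sum_c F c = F ChId + F ChU + F ChUdag + F ChSwap.
Proof.
rewrite (bigD1 ChId)//= (bigD1 ChU)//= (bigD1 ChUdag)//= (bigD1 ChSwap)//=.
by rewrite big_pred0 ?addr0 ?addrA//; case.
Qed.

Lemma weighted_mean_bounds (R : realDomainType) (I J : finType) (w : I -> R)
    (p : I -> J -> R) (M : R) :
  (forall n, 0 <= w n <= M) -> (forall n m, 0 <= p n m) ->
  \sum_n \sum_m p n m = 1 -> 0 <= \sum_n \sum_m w n * p n m <= M.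
Proof.
move=> wM p0 p1; apply/andP; split.
  apply: sumr_ge0 => n _; apply: sumr_ge0 => m _.
  by rewrite mulr_ge0//; case/andP: (wM n).
rewrite -[leRHS]mulr1 -p1 mulr_sumr; apply: ler_sum => n _.
rewrite mulr_sumr; apply: ler_sum => m _.
by rewrite ler_wpM2r//; case/andP: (wM n).
Qed.

(** * Mean energy of Gibbs states *)

Section Gibbs.
Variables (R : realType) (d : nat) (omega : 'I_d -> R).

Definition boltzmann (beta : R) (k : 'I_d) : R := expR (- beta * omega k).

Lemma Re_gibbs (beta : R) (n : 'I_d) :
  complex.Re (gibbs beta (hamiltonian omega) n n) =
    boltzmann beta n / \sum_k boltzmann beta k.
Proof.
rewrite /gibbs.
have -> : expmx (- beta%:C *: hamiltonian omega) =
    diag_mx (\row_k (boltzmann beta k)%:C).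
  rewrite (@expmx_spectral _ _ 'I_d _ (fun k => (- beta * omega k)%:C)
    (fun k => (boltzmann beta k)%:C) (fun k => delta_mx k k)).
  - by rewrite diag_mx_sum_delta; apply: eq_bigr => k _; rewrite mxE.
  - by rewrite -mx1_sum_delta.
  - move=> k; rewrite hamiltonian_diag -scalemxAl mul_diag_mx.
    apply/matrixP => i j; rewrite !mxE rmorphM rmorphN /=.
    case: eqP => [->|_] /=; last by rewrite !mulr0.
    by rewrite mulrA.
  - by move=> k; exact: expC_real.
rewrite mxtrace_diag !mxE eqxx mulr1n.
under eq_bigr do rewrite mxE.
rewrite -rmorph_sum -fmorphV -rmorphM /= mulrC.
by [].
Qed.

(** A symmetrization argument as in Chebyshev's sum inequality: over a common denominator, twice the
    difference of means is a sum over pairs of levels, each of the right sign because [expR] is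
    increasing. *)
Lemma boltzmann_mean_monotone (a b : R) : (0 < d)%N ->
  0 <= (a - b) * ((\sum_n omega n * (boltzmann b n / \sum_k boltzmann b k)) -
    \sum_n omega n * (boltzmann a n / \sum_k boltzmann a k)).
Proof.
move=> d0; have pos beta : 0 < \sum_k boltzmann beta k.
  rewrite (bigD1 (Ordinal d0))//= ltr_wpDr ?expR_gt0//.
  by apply: sumr_ge0 => k _; exact: expR_ge0.
set x := boltzmann a; set y := boltzmann b.
set X := \sum_k x k; set Y := \sum_k y k.
have X0 : X != 0 by rewrite gt_eqF// /X pos.
have Y0 : Y != 0 by rewrite gt_eqF// /Y pos.
have mean z Z : \sum_n omega n * (z n / Z) = (\sum_n omega n * z n) / Z :> R.
  by rewrite mulr_suml; apply: eq_bigr => n _; rewrite mulrA.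
rewrite !mean.
have cross (u v : 'I_d -> R) : (\sum_j omega j * u j) * (\sum_k v k) =
    \sum_j \sum_k omega j * (u j * v k).
  rewrite mulr_suml; apply: eq_bigr => j _; rewrite mulr_sumr.
  by apply: eq_bigr => k _; rewrite mulrA.
pose T := (\sum_n omega n * y n) * X - (\sum_n omega n * x n) * Y.
have T_ge0 : 0 <= (a - b) * T.
  (* Add to [T] its copy with [j] and [k] exchanged. *)
  have T2 : T *+ 2 = \sum_j \sum_k (omega j - omega k) * (y j * x k - x j * y k).
    rewrite mulr2n {1}/T /T !cross -!sumrB.
    rewrite [X in _ + X](_ : _ =
        \sum_j \sum_k (omega k * (y k * x j) - omega k * (x k * y j))).
      rewrite -big_split; apply: eq_bigr => j _; rewrite -sumrB -big_split.
      by apply: eq_bigr => k _ /=; ring.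
    rewrite [RHS]exchange_big; apply: eq_bigr => j _; rewrite -sumrB.
    by apply: eq_bigr.
  suff : 0 <= (a - b) * T *+ 2 by rewrite pmulrn_lge0.
  rewrite -mulrnAr T2 mulr_sumr; apply: sumr_ge0 => j _.
  rewrite mulr_sumr; apply: sumr_ge0 => k _.
  rewrite /x /y /boltzmann -!expRD mulrA.
  (* With these exponents the summand is [(u - v) * (expR u - expR v)]. *)
  set u := - b * omega j + _; set v := - a * omega j + _.
  have -> : (a - b) * (omega j - omega k) = u - v by rewrite /u /v; ring.
  have [uv|uv] := leP u v.
    by rewrite mulr_le0 ?subr_le0 ?ler_expR.
  by rewrite mulr_ge0 ?subr_ge0 ?ler_expR ?ltW.
rewrite (_ : _ / Y - _ / X = T / (X * Y)); last by rewrite /T; field; rewrite X0 Y0.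
by rewrite mulrA divr_ge0// mulr_ge0// ltW ?/X ?/Y ?pos.
Qed.

End Gibbs.

(** * Bounds on the heat *)

Section HeatBounds.
Variables (R : realType) (d : nat) (omega : 'I_d -> R).
Hypothesis omega_gt0 : forall k, 0 < omega k.
Implicit Types rho : 'M[R[i]]_(d * d).

Lemma omega_bounds k : 0 <= omega k <= omega_max omega.
Proof. by rewrite ltW//= /omega_max le_bigmax. Qed.

Lemma omega_max_ge0 : 0 <= omega_max omega.
Proof. by rewrite /omega_max bigmax_ge_id. Qed.

(** The diagonal of [rho] is a probability distribution on pairs of levels, so both mean energies
    lie between 0 and [omega_max omega]. *)
Lemma energy_gap_le rho : density_matrix rho ->
  `|energyB omega rho - energyA omega rho| <= omega_max omega.
Proof.
move=> rhoD; have [_ _ tr1] := rhoD.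
have p0 n m : 0 <= complex.Re (coef rho n m n m) by exact: density_diag_ge0.
have p1 : \sum_n \sum_m complex.Re (coef rho n m n m) = 1.
  rewrite sum_mxtens -[RHS]/(complex.Re (1 : R[i])) -tr1 Re_sum.
  apply: eq_bigr => i _.
  by rewrite /coef -surjective_pairing mxtens_unindexK.
have := weighted_mean_bounds omega_bounds p0 p1.
rewrite exchange_big /= in p1.
have := weighted_mean_bounds omega_bounds (fun n m => p0 m n) p1.
rewrite -/(energyA omega rho) -/(energyB omega rho) ler_norml.
lra.
Qed.

(** The factor 2 is the inverse of the weight 1/2 of [ChU] in the channel identity. The bound is
    symmetric, hence at least as strong as [nc_inequality] from below. *)
Lemma noncontextual_heat_bound g rho t : rho ^t* = rho ->
  F_noncontextual omega g rho t ->
  `|heat omega g rho t| <= 2 * omega_max omega * sin (g * t) ^+ 2.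
Proof.
move=> rhoH [disp [L [mu [Gamma [xi [model nonctx]]]]]].
pose c2 := cos (g * t) ^+ 2; pose s2 := sin (g * t) ^+ 2.
pose w c : R := match c with ChU | ChUdag => 2^-1 | _ => 0 end.
pose v c : R := match c with ChId => c2 | ChSwap => s2 | _ => 0 end.
have := nonctx w v.
have c2_ge0 : 0 <= c2 by exact: sqr_ge0.
have s2_ge0 : 0 <= s2 by exact: sqr_ge0.
have wconv : convex_weights w.
  split; first by case=> /=; rewrite ?invr_ge0.
  by rewrite sum_channel /=; field.
have vconv : convex_weights v.
  split; first by case=> /=.
  by rewrite sum_channel /= !addr0 cos2Dsin2.
have mixE (X : 'M[R[i]]_(d * d)) :
    channel_mix (F_channel g t) w X = channel_mix (F_channel g t) v X.
  rewrite /channel_mix !sum_channel F_channelUE F_channelUdagE /=.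
  rewrite !scale0r !addr0 add0r.
  (* What remains is that the mean of [Y + Z] and [Y - Z] is [Y], where [Z] is the commutator
     term. *)
  move: (('i%C * _) *: _) => Z; move: (_ *: X + _) => Y.
  rewrite fmorphV rmorph_nat; apply/matrixP => i j.
  by rewrite !mxE; field.
move=> /(_ wconv vconv mixE) mix.
have mix' : {ae mu, forall l, forall A : set L, measurable A ->
    (2^-1%:E * Gamma ChU l A + 2^-1%:E * Gamma ChUdag l A =
     c2%:E * Gamma ChId l A + s2%:E * Gamma ChSwap l A)%E}.
  apply: filterS mix => l H A mA; have := H A mA.
  by rewrite !sum_channel /= !mul0e !adde0 !add0e.
have half0 : 0 < 2^-1 :> R by rewrite invr_gt0.
have val_ge0 (k : seq_sub (codom omega)) : 0 <= ssval k.
  by case: k => x /= /codomP[i ->]; exact: ltW.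
have val_le (k : seq_sub (codom omega)) : ssval k <= omega_max omega.
  by case: k => x /= /codomP[i ->]; case/andP: (omega_bounds i).
have := energy_change_le model val_ge0 val_le half0 c2_ge0 s2_ge0 mix'.
rewrite !energy_effects /=.
have -> : complex.Re (\tr (localA (hamiltonian omega) *m
    (U_PS d g t *m rho *m (U_PS d g t) ^t*))) -
    complex.Re (\tr (localA (hamiltonian omega) *m rho)) = heat omega g rho t.
  rewrite /heat mulmxBr raddfB /=.
  by case: (\tr _) => ? ?; case: (\tr _).
by rewrite -/s2; lra.
Qed.

End HeatBounds.

(** The difference of the two sides is continuous and equals [K] at 0. Capping the radius at [pi]
    keeps the sine positive. *)
Lemma cos_dominates_sin (R : realType) (K C : R) : 0 < K ->
  exists2 e : R, 0 < e & forall x, 0 < x < e -> 0 < sin x /\ C * sin x < K * cos x.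
Proof.
move=> K0; pose f (x : R) := K * cos x - C * sin x.
have f0 : 0 < f 0 by rewrite /f cos0 sin0; lra.
have cf : {for 0, continuous f}.
  apply: continuousB; apply: continuousM; try exact: cst_continuous.
    exact: continuous_cos.
  exact: continuous_sin.
have : \forall x \near (0 : R), 0 < f x.
  exact: cvgr_gt cf _ f0.
case/nbhs_ballP => e /= e0 fe.
exists (Num.min e pi); first by rewrite lt_min e0 pi_gt0.
move=> x /andP[x0]; rewrite lt_min => /andP[xe xpi]; split.
  by rewrite sin_gt0_pi// x0.
have := fe x; rewrite /ball /= sub0r normrN gtr0_norm// => /(_ xe).
by rewrite /f subr_gt0.
Qed.

Theorem mainTheorem4 (R : realType) (d : nat) (hd : (2 <= d)%N)
    (omega : 'I_d -> R) (homega : forall k, 0 < omega k)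
    (g : R) (hg : 0 < g)
    (rho : 'M[R[i]]_(d * d)) (hrho : density_matrix rho) :
  [/\ (* violation of the inequality excludes noncontextual models *)
      forall t : R, 0 < t ->
        ~ nc_inequality omega g rho t -> ~ F_noncontextual omega g rho t,
      (* (i) *)
      \sum_(n < d) \sum_(m < d) complex.Im (coef rho n m m n) * omega n != 0
      <-> (exists2 tau_c : R, 0 < tau_c &
             forall t : R, 0 < t < tau_c -> ~ nc_inequality omega g rho t)
    & (* (ii) *)
      forall beta_A beta_B : R, 0 < beta_A -> 0 < beta_B -> beta_A != beta_B ->
        reducedA rho = gibbs beta_A (hamiltonian omega) ->
        reducedB rho = gibbs beta_B (hamiltonian omega) ->
        exists2 tau_c : R, 0 < tau_c &
          forall t : R, 0 < t < tau_c ->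
            (beta_A - beta_B) * heat omega g rho t < 0 ->
            ~ nc_inequality omega g rho t].
Proof.
have [rhoH _ _] := hrho.
have M0 := omega_max_ge0 omega.
have gap := energy_gap_le homega hrho.
rewrite -/(coherence omega rho).
have violation : coherence omega rho != 0 -> exists2 tau_c : R, 0 < tau_c &
    forall t : R, 0 < t < tau_c -> ~ nc_inequality omega g rho t.
  move=> C0; have K0 : 0 < 2 * `|coherence omega rho|.
    by rewrite mulr_gt0// normr_gt0.
  (* The constant 5 is the 4 of the lower bound plus 1 for the energy gap; the upper bound would
     only take 2 + 1. *)
  have [e e0 He] := cos_dominates_sin (5 * omega_max omega) K0.
  exists (e / g); first by rewrite divr_gt0.
  move=> t /andP[t0 te].
  have [] := He (g * t); first by rewrite mulr_gt0//= mulrC -ltr_pdivlMr.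
  rewrite /nc_inequality heatE// => s0.
  (* Multiplying by the positive sine makes the comparison one with the squared sine of the
     inequality. *)
  rewrite -(ltr_pM2l s0); move: gap; rewrite ler_norml.
  set D := _ - energyA _ _; set s := sin _; set c := cos _.
  set C := coherence _ _; set M := omega_max _ => /andP[D_ge D_le] sc.
  have s2 : 0 <= s ^+ 2 by exact: sqr_ge0.
  have sD_le := ler_wpM2l s2 D_le; have sD_ge := ler_wpM2l s2 D_ge.
  have sM := mulr_ge0 s2 M0; rewrite -/M in sM.
  move/andP => [lo hi]; move: sc lo hi sD_le sD_ge sM.
  (* A positive coherence sum breaks the lower bound, a negative one the upper bound. *)
  have [_|_] := ger0P C; lra.
split.
- move=> t _ viol nc; apply: viol.
  have := noncontextual_heat_bound homega rhoH nc.
  rewrite /nc_inequality ler_norml => /andP[lo ->]; rewrite andbT.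
  apply: le_trans lo; rewrite -mulNr ler_wpM2r ?sqr_ge0//.
  by move: M0; lra.
- split; first exact: violation.
  (* Without coherence the heat is the squared sine times the energy gap, which meets both bounds at
     any time, here [tau / 2]. *)
  case=> tau tau0 viol; apply/eqP => C0.
  have := viol (tau / 2); apply; first by apply/andP; split; lra.
  rewrite /nc_inequality heatE// C0 mulr0 subr0.
  move: gap; rewrite ler_norml => /andP[lo hi].
  have := sqr_ge0 (sin (g * (tau / 2))); set q := _ ^+ 2 => q0.
  by apply/andP; split; nra.
move=> bA bB bA0 bB0 _ redA redB.
have [C0|] := eqVneq (coherence omega rho) 0; last first.
  by case/violation => tau tau0 viol; exists tau => // t /viol.
(* Any positive [tau_c] would do: with zero coherence sum, monotonicity of the Gibbs mean energy
   contradicts [anomalous] at every time. *)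
exists 1 => // t _; rewrite heatE// C0 mulr0 subr0 => anomalous.
have EA : energyA omega rho =
    \sum_n omega n * (boltzmann omega bA n / \sum_k boltzmann omega bA k).
  apply: eq_bigr => n _; rewrite -Re_gibbs -redA mxE Re_sum mulr_sumr.
  by [].
have EB : energyB omega rho =
    \sum_n omega n * (boltzmann omega bB n / \sum_k boltzmann omega bB k).
  apply: eq_bigr => n _; rewrite -Re_gibbs -redB mxE Re_sum mulr_sumr.
  by [].
have := boltzmann_mean_monotone omega bA bB (ltnW hd); rewrite -EA -EB => mono.
move: anomalous; rewrite mulrCA ltNge => /negP; case.
by rewrite mulr_ge0 ?sqr_ge0.
Qed.
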